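(* Let $n\ge 3$ and $N>2$ be integers and let $f\colon[-1,1)\to\mathbb{R}$ be a potential function. The minimal value (infimum) of $\widetilde{E}_f(\mathcal{C})$ over all sets $\mathcal{C}\subset S^{n-1}$ of $N$ points is greater than or equal to the optimum (infimum) of the following semidefinite program: minimize $$\frac{1}{6(N-2)}\sum_{(u,v,t)\in D}A_{u,v,t}\big(f(u)+f(v)+f(t)\big)$$ over all choices of $A_{u,v,t}\ge 0$ for $(u,v,t)\in D$ (with only finitely many $A_{u,v,t}$ nonzero), subject to $$\sum_{(u,v,t)\in D}A_{u,v,t}=N(N-1)(N-2)$$ and, for all integers $k\ge 0$, $$N(N-2)\,\delta_{k,0}\,J+\sum_{(u,v,t)\in D}A_{u,v,t}\,T^n_k(u,v,t)\succeq 0.$$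
   Context: For a function $f\colon[-1,1)\to\mathbb{R}$ and a finite set $\mathcal{C}\subset S^{n-1}$ (the unit sphere in $\mathbb{R}^n$), $\widetilde{E}_f(\mathcal{C})=\frac12\sum_{x,y\in\mathcal{C},\,x\ne y}f(\langle x,y\rangle)$. Set $$D=\{(u,v,t)\in\mathbb{R}^3:-1\le u,v,t<1\text{ and }1+2uvt-u^2-v^2-t^2\ge 0\}.$$ For $m\ge 2$, $P^m_k$ denotes the degree $k$ Gegenbauer polynomial for $S^{m-1}$: these polynomials are orthogonal with respect to $(1-t^2)^{(m-3)/2}\,dt$ on $[-1,1]$ and normalized by $P^m_k(1)=1$. $S^n_k(u,v,t)$ is the infinite matrix whose $(i,j)$-entry ($i,j=0,1,2,\dots$) is the symmetrization in $u,v,t$ (the average over all $6$ permutations of the variables) of $$u^iv^j\big((1-u^2)(1-v^2)\big)^{k/2}P^{n-1}_k\left(\frac{t-uv}{\sqrt{(1-u^2)(1-v^2)}}\right),$$ which is a polynomial in $u,v,t$ (and is interpreted as such wherever the formula is undefined). Define $$T^n_k(u,v,t)=(N-2)S^n_k(u,v,t)+S^n_k(u,u,1)+S^n_k(v,v,1)+S^n_k(t,t,1).$$ $J$ is the infinite matrix (indexed by $i,j\ge 0$) with all entries $1$, and $\delta$ is the Kronecker delta. For an infinite real symmetric matrix $A$, $A\succeq 0$ means positive semidefinite, i.e. $\sum_{i,j}A_{i,j}v_iv_j\ge 0$ for all finitely supported real vectors $v$. *)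

(* Defs.v *)
From HB Require Import structures.
From mathcomp Require Import all_boot all_order all_algebra finmap ring.
From mathcomp Require Import all_classical all_reals all_analysis.

Set Implicit Arguments.
Unset Strict Implicit.
Unset Printing Implicit Defensive.

Import Order.TTheory GRing.Theory Num.Theory.
Import numFieldNormedType.Exports.

Local Open Scope classical_set_scope.
Local Open Scope ring_scope.

(** ** Codes on the unit sphere and their energy *)

Definition dotp (R : realType) (n : nat) (x y : 'rV[R]_n) : R :=
  \sum_(i < n) x ord0 i * y ord0 i.

Definition sphere_codes (R : realType) (n N : nat) : set {fset 'rV[R]_n} :=
  [set C : {fset 'rV[R]_n} |
    #|` C| = N /\ (forall x, x \in C -> dotp x x = 1)].

(** A potential [-1, 1) -> R is a total function [f : R -> R]: both the energy
    and the semidefinite program read only its values on [-1, 1). *)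
Definition energy (R : realType) (n : nat) (f : R -> R)
    (C : {fset 'rV[R]_n}) : R :=
  2^-1 * \sum_(x <- C) \sum_(y <- C | x != y) f (dotp x y).

(** ** Gegenbauer polynomials *)

Definition is_gegenbauer (R : realType) (m : nat) (P : nat -> {poly R}) : Prop :=
  [/\ forall k, size (P k) = k.+1,
      forall k, (P k).[1] = 1
    & forall j k, j != k ->
        \int[@lebesgue_measure R]_(t in `[(-1), 1])
          ((P j).[t] * (P k).[t] * (1 - t ^+ 2) `^ ((m%:R - 3) / 2)) = 0].

(** For m >= 2 the weight is integrable and [is_gegenbauer m] determines the
    family uniquely, so the choice below is not arbitrary. *)
Definition gegenbauer (R : realType) (m : nat) : nat -> {poly R} :=
  xget (fun=> 0) [set P | is_gegenbauer m P].

(** ** The matrices S and T *)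

(** With s = sqrt ((1 - u^2)(1 - v^2)) and P the Gegenbauer polynomial of degree
    k for S^(n-2), this is s^k P((t - uv) / s) with the powers of s multiplied
    out, which also makes sense for s = 0. As P has the parity of k, only even
    powers of s occur, so on [-1, 1]^3 this is a polynomial in u, v, t. *)
Definition Qker (R : realType) (n k : nat) (u v t : R) : R :=
  \sum_(l < k.+1) (gegenbauer R n.-1 k)`_l * (t - u * v) ^+ l
     * Num.sqrt ((1 - u ^+ 2) * (1 - v ^+ 2)) ^+ (k - l).

Lemma size_gegenbauer (R : realType) (m k : nat) :
  (size (gegenbauer R m k) <= k.+1)%N.
Proof.
rewrite /gegenbauer; case: xgetP => [P -> [sP _ _]|_]; first by rewrite sP.
by rewrite size_poly0.
Qed.

Lemma QkerE (R : realType) (n k : nat) (u v t : R) :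
  0 < (1 - u ^+ 2) * (1 - v ^+ 2) ->
  Qker n k u v t =
    ((1 - u ^+ 2) * (1 - v ^+ 2)) `^ (k%:R / 2) *
    (gegenbauer R n.-1 k).[(t - u * v) /
                           Num.sqrt ((1 - u ^+ 2) * (1 - v ^+ 2))].
Proof.
move=> w0; rewrite /Qker; move: w0.
set w := (1 - u ^+ 2) * _ => w0.
have s0 : Num.sqrt w != 0 by rewrite gt_eqF // sqrtr_gt0.
rewrite [k%:R / 2]mulrC powRrM powR12_sqrt ?ltW// powR_mulrn ?sqrtr_ge0//.
rewrite (horner_coef_wide _ (size_gegenbauer R n.-1 k)) mulr_sumr.
apply: eq_bigr => l _; rewrite expr_div_n.
have lk : (l <= k)%N by rewrite -ltnS.
have -> : Num.sqrt w ^+ k = Num.sqrt w ^+ (k - l) * Num.sqrt w ^+ l.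
  by rewrite -exprD subnK.
by field; rewrite expf_neq0.
Qed.

Definition symmetrize (R : realType) (g : R -> R -> R -> R) (u v t : R) : R :=
  6^-1 * (g u v t + g u t v + g v u t + g v t u + g t u v + g t v u).

Definition Smx (R : realType) (n k : nat) (u v t : R) (i j : nat) : R :=
  symmetrize (fun u v t => u ^+ i * v ^+ j * Qker n k u v t) u v t.

Lemma SmxC (R : realType) (n k : nat) (u v t : R) (i j : nat) :
  Smx n k u v t i j = Smx n k u v t j i.
Proof.
have QC x y z : Qker n k x y z = Qker n k y x z :> R.
  by apply: eq_bigr => l _; rewrite (mulrC x) (mulrC (1 - x ^+ 2)).
rewrite /Smx /symmetrize (QC v u) (QC t u) (QC t v).
by ring.
Qed.

Definition Tmx (R : realType) (n N k : nat) (u v t : R) (i j : nat) : R :=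
  (N%:R - 2) * Smx n k u v t i j
  + Smx n k u u 1 i j + Smx n k v v 1 i j + Smx n k t t 1 i j.

(** ** The semidefinite program *)

Definition Dset (R : realType) : set (R * R * R) :=
  [set w | let: (u, v, t) := w in
    [/\ -1 <= u < 1, -1 <= v < 1, -1 <= t < 1
      & 0 <= 1 + 2 * u * v * t - u ^+ 2 - v ^+ 2 - t ^+ 2]].

(** Meant for symmetric M; see [SmxC] for the matrices used below. *)
Definition infmx_psd (R : realType) (M : nat -> nat -> R) : Prop :=
  forall v : nat -> R, finite_set [set i | v i != 0] ->
    0 <= \sum_(i \in [set: nat]) \sum_(j \in [set: nat]) M i j * v i * v j.

Definition sdp_feasible (R : realType) (n N : nat) : set (R * R * R -> R) :=
  [set A | [/\ forall w, Dset w -> 0 <= A w,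
      finite_set [set w | Dset w /\ A w != 0],
      \sum_(w \in @Dset R) A w = N%:R * (N%:R - 1) * (N%:R - 2)
    & (* the term N (N - 2) (k == 0) is the entry of N (N - 2) delta_(k,0) J *)
      forall k : nat, infmx_psd (fun i j =>
        N%:R * (N%:R - 2) * (k == 0%N)%:R
        + \sum_(w \in @Dset R)
            let: (u, v, t) := w in A w * Tmx n N k u v t i j)]].

Definition sdp_objective (R : realType) (N : nat) (f : R -> R)
    (A : R * R * R -> R) : R :=
  (6 * (N%:R - 2))^-1 *
  \sum_(w \in @Dset R) let: (u, v, t) := w in A w * (f u + f v + f t).

(* Main.v *)
(** Given a code C of N points, let A_(u,v,t) be the number of ordered triples
    of distinct points of C with inner products u, v, t. Its objective is the
    energy of C, because each ordered pair lies in N - 2 triples for each of the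
    three positions. Adding the degenerate triples (x, x, y) and (x, x, x) turns
    N (N - 2) delta_(k,0) J + sum A T_k into N - 2 times the sum of S_k over all
    of C^3, so the constraint is the Bachoc-Vallentin inequality: for a fixed
    unit vector z, the kernel
      (x, y) |-> |x'|^k |y'|^k P_k(<x', y'> / |x'| |y'|),
    with x', y' the projections on the orthogonal complement of z, is positive
    semidefinite.

    Orthogonality forces P_k to satisfy the Gegenbauer differential equation.
    Hence the polynomial Z_y(X) = |X|^k |y|^k P_k(<X, y> / |X| |y|) is harmonic,
    and since harmonic polynomials are orthogonal to multiples of |X|^2 for the
    Fischer product, that product of Z_x and Z_y is a positive multiple of
    Z_y(x): the kernel is a Gram matrix. *)

From HB Require Import structures.
Require Import Defs.
From mathcomp Require Import all_boot all_order all_algebra zify ring lra.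
From mathcomp Require mpoly.

Set Implicit Arguments.
Unset Strict Implicit.
Unset Printing Implicit Defensive.

Import Order.TTheory GRing.Theory Num.Theory.

Local Open Scope ring_scope.

(** * Zonal harmonics and the Fischer product *)

(* The notations of [mpoly] clash with those of the analysis library, which is
   therefore imported only after this section. *)
Section fischer.
Import mpoly.
Variables (R : realDomainType) (m : nat).
Implicit Types (p q r : {mpoly R[m]}) (x y : 'I_m -> R).

(** Unfolded, this sums over all sequences of [k] indices the products of the iterated partial
    derivatives of [p] and [q] at 0. It is [k!] times the usual Fischer product of the components of
    degree [k]. *)
Fixpoint fischer k p q : R :=
  if k is k'.+1 then \sum_(i < m) fischer k' p^`M(i) q^`M(i)
  else p.@[fun=> 0] * q.@[fun=> 0].

Lemma fischerC k p q : fischer k p q = fischer k q p.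
Proof.
by elim: k p q => /= [|k IH] p q; [exact: mulrC|apply: eq_bigr => i _].
Qed.

Lemma fischer_is_scalar k p : scalar (fischer k p).
Proof.
elim: k p => /= [|k IH] p a q1 q2.
  by rewrite mevalD mevalZ mulrDr mulrCA.
under eq_bigr do rewrite mderivD mderivZ IH.
by rewrite big_split/= -mulr_sumr.
Qed.
HB.instance Definition _ k p :=
  GRing.isLinear.Build R {mpoly R[m]} R _ (fischer k p)
    (@fischer_is_scalar k p).

Lemma fischerDl k p q r : fischer k (p + q) r = fischer k p r + fischer k q r.
Proof. by rewrite fischerC linearD/= !(fischerC _ r). Qed.

Lemma fischerZl k a p q : fischer k (a *: p) q = a * fischer k p q.
Proof. by rewrite fischerC linearZ/= !(fischerC _ q). Qed.

Lemma fischer_suml k (I : Type) (s : seq I) (P : pred I)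
    (F : I -> {mpoly R[m]}) q :
  fischer k (\sum_(i <- s | P i) F i) q = \sum_(i <- s | P i) fischer k (F i) q.
Proof.
by rewrite fischerC linear_sum/=; apply: eq_bigr => i _; rewrite fischerC.
Qed.

Lemma fischer_ge0 k p : 0 <= fischer k p p.
Proof.
elim: k p => /= [|k IH] p; first exact: sqr_ge0.
by apply: sumr_ge0 => i _.
Qed.

Lemma mderivXU i j : ('X_j : {mpoly R[m]})^`M(i) = (j == i)%:R.
Proof.
rewrite mderivX mnmE eq_sym; case: eqVneq => [->|]; last by rewrite scale0r.
rewrite (_ : (_ - _)%MM = 0%MM) ?mpolyX0 ?scale1r//.
by apply/mnmP => l; rewrite mnmBE subnn mnm0E.
Qed.

Lemma mderiv_exp i p n : (p ^+ n)^`M(i) = n%:R * p ^+ n.-1 * p^`M(i).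
Proof.
elim: n => [|n IH]; first by rewrite expr0 mulr0n !mul0r -[1]/(1%:MP) mderivC.
rewrite exprS mderivM IH; move: (p^`M(i)) => d.
by case: n {IH} => [|n] /=; rewrite ?exprS; ring.
Qed.

Lemma mderiv_natr i n : (n%:R : {mpoly R[m]})^`M(i) = 0.
Proof. by rewrite -(rmorph_nat (@mpolyC m R)) mderivC. Qed.

(** Multiplication by ['X_i] is adjoint to the [i]-th derivative up to a factor. By the Leibniz
    rule, one copy comes from differentiating ['X_i], the others from the induction hypothesis. *)
Lemma fischer_XM k i p q :
  fischer k.+1 ('X_i * p) q = k.+1%:R * fischer k p q^`M(i).
Proof.
elim: k p q => [|k IH] p q.
  rewrite /= (bigD1 i)//= big1 ?addr0 => [|j ji].
    rewrite mderivM mderivXU eqxx mul1r mevalD mevalM mevalXU.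
    by rewrite mul0r addr0 mul1r.
  rewrite mderivM mderivXU eq_sym (negbTE ji) mul0r add0r mevalM mevalXU.
  by rewrite !mul0r.
rewrite [LHS]/=.
under eq_bigr => j _ do
  rewrite -[\sum_(_ < _) _]/(fischer k.+1 _ _) mderivM mderivXU fischerDl IH.
rewrite big_split/= -mulr_sumr (_ : \sum_(j < m) _ = fischer k.+1 p q^`M(i)).
  rewrite -[k.+2]add1n natrD mulrDl mul1r; congr (_ + _ * _).
  by apply: eq_bigr => j _; rewrite mderiv_comm.
rewrite (bigD1 i)//= [X in _ + X]big1 ?addr0 ?eqxx ?mul1r// => j ji.
rewrite eq_sym (negbTE ji) mul0r big1// => l _.
by rewrite mderiv0 fischerC linear0.
Qed.

Arguments fischer : simpl never.

Definition normsq : {mpoly R[m]} := \sum_(i < m) 'X_i ^+ 2.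
Definition lform x : {mpoly R[m]} := \sum_(i < m) x i *: 'X_i.
Definition laplacian p : {mpoly R[m]} := \sum_(i < m) p^`M(i)^`M(i).

Lemma laplacianZ a p : laplacian (a *: p) = a *: laplacian p.
Proof. by rewrite scaler_sumr; apply: eq_bigr => i _; rewrite !mderivZ. Qed.

Lemma laplacian_sum (I : Type) (s : seq I) (F : I -> {mpoly R[m]}) :
  laplacian (\sum_(i <- s) F i) = \sum_(i <- s) laplacian (F i).
Proof.
rewrite /laplacian [RHS]exchange_big/=; apply: eq_bigr => i _.
by rewrite -[RHS]linear_sum -linear_sum.
Qed.

Lemma mderiv_normsq i : normsq^`M(i) = 2 * 'X_i.
Proof.
rewrite /normsq linear_sum/= (bigD1 i)//= big1 ?addr0 => [|j ji].
  by rewrite mderiv_exp mderivXU eqxx expr1 mulr1.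
by rewrite mderiv_exp mderivXU (negbTE ji) mulr0.
Qed.

Lemma mderiv_lform i x : (lform x)^`M(i) = (x i)%:MP.
Proof.
rewrite /lform linear_sum/= (bigD1 i)//= big1 ?addr0 => [|j ji].
  by rewrite mderivZ mderivXU eqxx alg_mpolyC.
by rewrite mderivZ mderivXU (negbTE ji) scaler0.
Qed.

(** Two uses of [fischer_XM] per square: the adjoint of multiplication by [normsq] is a multiple of
    the Laplacian. *)
Lemma fischer_normsqM k p q :
  fischer k.+2 (normsq * p) q = (k.+2 * k.+1)%:R * fischer k p (laplacian q).
Proof.
rewrite /normsq mulr_suml fischer_suml /laplacian linear_sum/= mulr_sumr.
by apply: eq_bigr => i _; rewrite expr2 -mulrA !fischer_XM mulrA natrM.
Qed.

Lemma fischer_normsqM_harmonic k p q : (2 <= k)%N -> laplacian q = 0 ->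
  fischer k (normsq * p) q = 0.
Proof.
by case: k => [|[|k]]// _ q0; rewrite fischer_normsqM q0 linear0 mulr0.
Qed.

(* Satisfied by all homogeneous [q] of degree [k]: [lform x ^+ k] represents the
   evaluation at [x] for the Fischer product. *)
Definition reproduced k q : Prop :=
  forall x, fischer k q (lform x ^+ k) = (k`! ^ 2)%:R * q.@[x].

Lemma reproduced1 : reproduced 0 1.
Proof. by move=> x; rewrite /fischer expr0 !meval1 mulr1. Qed.

Lemma reproducedZ k a q : reproduced k q -> reproduced k (a *: q).
Proof. by move=> hq x; rewrite fischerZl hq mevalZ mulrCA. Qed.

Lemma reproduced_sum k (I : Type) (s : seq I) (F : I -> {mpoly R[m]}) :
  (forall i, reproduced k (F i)) -> reproduced k (\sum_(i <- s) F i).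
Proof.
move=> hF x; rewrite fischer_suml raddf_sum mulr_sumr.
by apply: eq_bigr => i _; exact: hF.
Qed.

Lemma reproducedXM k i q : reproduced k q -> reproduced k.+1 ('X_i * q).
Proof.
move=> hq x; rewrite fischer_XM mderiv_exp mderiv_lform /=.
rewrite (_ : _ * _ * _ = (k.+1%:R * x i) *: lform x ^+ k); last first.
  by rewrite -mul_mpolyC rmorphM rmorph_nat/= mulrAC.
rewrite linearZ/= hq mevalM mevalXU factS expnMn !natrM; ring.
Qed.

Lemma reproduced_lformM k y q : reproduced k q -> reproduced k.+1 (lform y * q).
Proof.
move=> hq; rewrite mulr_suml; apply: reproduced_sum => i.
by rewrite -scalerAl; apply/reproducedZ/reproducedXM.
Qed.

Lemma reproduced_normsqM k q : reproduced k q -> reproduced k.+2 (normsq * q).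
Proof.
move=> hq; rewrite mulr_suml; apply: reproduced_sum => i.
by rewrite expr2 -mulrA; apply/reproducedXM/reproducedXM.
Qed.

Lemma reproduced_normsq_lform a j y :
  reproduced (a.*2 + j) (normsq ^+ a * lform y ^+ j).
Proof.
elim: a => [|a IH]; last by rewrite exprS -mulrA; exact: reproduced_normsqM.
rewrite expr0 mul1r; elim: j => [|j IH]; first exact: reproduced1.
by rewrite exprS; exact: reproduced_lformM.
Qed.

Definition dotf x y : R := \sum_(i < m) x i * y i.

(** The truncated exponents [a.-1] and [j.-2] are harmless, since the coefficients vanish for
    [a = 0] and for [j < 2]. *)
Lemma laplacian_normsq_lform a j y :
  laplacian (normsq ^+ a * lform y ^+ j) =
    (a.*2 * (m + a.*2 + j.*2 - 2))%:R *: (normsq ^+ a.-1 * lform y ^+ j)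
    + ((j * j.-1)%:R * dotf y y) *: (normsq ^+ a * lform y ^+ j.-2).
Proof.
have dd i : ((normsq ^+ a * lform y ^+ j)^`M(i))^`M(i) =
    (a.*2)%:R * (normsq ^+ a.-1 * lform y ^+ j)
    + (2 * a.*2 * a.-1)%:R * (normsq ^+ a.-2 * lform y ^+ j) * 'X_i ^+ 2
    + (2 * a.*2 * j)%:R * (normsq ^+ a.-1 * lform y ^+ j.-1) * (y i *: 'X_i)
    + (j * j.-1)%:R * (normsq ^+ a * lform y ^+ j.-2) * (y i * y i)%:MP.
  rewrite !(mderivM, mderiv_exp, mderiv_normsq, mderiv_lform, mderivD).
  rewrite !mderiv_natr mderivXU eqxx -!mul_mpolyC.
  rewrite [(y i * y i)%:MP]rmorphM/= -muln2 !natrM.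
  rewrite mderivC (mderiv_natr i 1).
  move: (_ ^+ a) (_ ^+ a.-1) (_ ^+ a.-2) (_ ^+ j) (_ ^+ j.-1) (_ ^+ j.-2).
  by move: (_%:MP) => *; ring.
rewrite /laplacian (eq_bigr _ (fun i _ => dd i)) !big_split/=.
rewrite sumr_const card_ord -[_ *+ m]mulr_natr -!mulr_sumr -/normsq -/(lform y).
rewrite -(rmorph_sum (@mpolyC m R)) -/(dotf y y).
rewrite -!mul_mpolyC !rmorphM !rmorph_nat/=.
congr (_ + _); last by rewrite mulrAC.
case: a {dd} => [|a]; first by rewrite !(mul0r, muln0, addr0).
have -> : (m + a.+1.*2 + j.*2 - 2 = m + a.*2 + j.*2)%N.
  by rewrite doubleS !addnS !addSn subSS subSS subn0.
(* The cross terms rebuild [normsq] and [lform y]. The factors [a] and [j] absorb the case of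
   exponent 0, where [.-1] does not lower the exponent. *)
have hN : a%:R * normsq ^+ a.-1 * normsq = a%:R * normsq ^+ a.
  by case: a => [|a]; rewrite ?mul0r// -mulrA -exprSr.
have hL : j%:R * lform y ^+ j.-1 * lform y = j%:R * lform y ^+ j.
  by case: j => [|j]; rewrite ?mul0r// -mulrA -exprSr.
transitivity (a.+1.*2%:R * normsq ^+ a * lform y ^+ j * m%:R
   + (2 * a.+1.*2)%:R * (a%:R * normsq ^+ a.-1 * normsq) * lform y ^+ j
   + (2 * a.+1.*2)%:R * normsq ^+ a * (j%:R * lform y ^+ j.-1 * lform y)).
  rewrite [a.+1.-1]/= [a.+1.-2]/=.
  move: (a.+1.*2%:R) (_ ^+ a) (_ ^+ a.-1) (_ ^+ j) (_ ^+ j.-1) => *.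
  ring.
rewrite hN hL -!muln2 !natrD !natrM.
by ring.
Qed.

(** * Zonal harmonics built from the coefficients of a Gegenbauer polynomial *)

Section zonal.
Variables (k p : nat) (c : nat -> R).
Hypothesis mE : m = p.+2.
Hypothesis c_rec : forall i, (i <= k)%N ->
  (i.+2 * i.+1)%:R * c i.+2 = - ((k - i) * (k + i + p))%:R * c i.
Hypothesis c_odd : forall i, (i <= k)%N -> odd (k - i) -> c i = 0.

(** This is [|X|^k |y|^k P(<X, y> / |X| |y|)] for [P] with coefficients [c]. [c_rec] is the
    Gegenbauer equation read coefficientwise; by [c_odd], the halving is exact wherever [c j] is
    nonzero. *)
Definition zonal y : {mpoly R[m]} :=
  \sum_(j < k.+1) (c j * dotf y y ^+ (k - j)./2)
    *: (normsq ^+ (k - j)./2 * lform y ^+ j).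

Definition zonalker x y : R :=
  \sum_(j < k.+1) c j * (dotf x x * dotf y y) ^+ (k - j)./2 * dotf x y ^+ j.

Lemma meval_zonal x y : (zonal y).@[x] = zonalker x y.
Proof.
have hL : (lform y).@[x] = dotf x y.
  rewrite /lform raddf_sum; apply: eq_bigr => i _ /=.
  by rewrite mevalZ mevalXU mulrC.
have hN : normsq.@[x] = dotf x x.
  rewrite /normsq raddf_sum; apply: eq_bigr => i _ /=.
  by rewrite mevalM mevalXU.
rewrite /zonal raddf_sum; apply: eq_bigr => j _ /=.
rewrite mevalZ mevalM !rmorphXn/= hL hN exprMn; ring.
Qed.

Lemma reproduced_zonal y : reproduced k (zonal y).
Proof.
apply: reproduced_sum => j; have jk : (j <= k)%N by rewrite -ltnS.
have [o|e] := boolP (odd (k - j)).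
  by rewrite c_odd// mul0r scale0r => x; rewrite fischerC linear0 meval0 mulr0.
have {1}-> : (k = (k - j)./2.*2 + j)%N by rewrite even_halfK// subnK.
exact/reproducedZ/reproduced_normsq_lform.
Qed.

(** The Laplacian of the [j]-th term consists of [U j] and [V j]. Both [U j] and [V j.+2] are
    multiples of the same polynomial, and [c_rec] makes them cancel. *)
Lemma laplacian_zonal y : laplacian (zonal y) = 0.
Proof.
pose s := dotf y y; pose h j := (k - j)./2.
pose U j : {mpoly R[m]} :=
  (c j * s ^+ h j * ((h j).*2 * (m + (h j).*2 + j.*2 - 2))%:R) *:
  (normsq ^+ (h j).-1 * lform y ^+ j).
pose V j : {mpoly R[m]} := (c j * s ^+ h j * ((j * j.-1)%:R * s))
  *: (normsq ^+ h j * lform y ^+ j.-2).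
have -> : laplacian (zonal y) = \sum_(j < k.+1) (U j + V j).
  rewrite /zonal laplacian_sum; apply: eq_bigr => j _.
  by rewrite laplacianZ laplacian_normsq_lform scalerDr !scalerA.
have UV j : (j.+2 <= k)%N -> U j + V j.+2 = 0.
  move=> jk; have jk' : (j <= k)%N by rewrite (leq_trans _ jk)// ltnW.
  have kj : (k - j = (k - j.+2).+2)%N by rewrite subnSK// subnSK// ltnW.
  have hj : h j = (h j.+2).+1 by rewrite /h kj.
  have [o|e] := boolP (odd (k - j)).
    have o2 : odd (k - j.+2) by move: o; rewrite kj /= negbK.
    by rewrite /U /V !c_odd// !mul0r !scale0r addr0.
  have h2 : ((h j).*2 = k - j)%N by rewrite even_halfK.
  rewrite /U /V h2 hj/= -scalerDl.
  (* Here the dimension [m = p + 2] is matched with the constant [p] of the recursion. *)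
  have -> : (m + (k - j) + j.*2 - 2 = k + j + p)%N.
    by rewrite mE -addnn; lia.
  have := c_rec jk'; rewrite /= => hc.
  rewrite (_ : _ + _ = s ^+ (h j.+2).+1 * ((k - j) * (k + j + p))%:R * c j
     + s ^+ (h j.+2).+1 * ((j.+2 * j.+1)%:R * c j.+2)); last first.
    by rewrite exprS; ring.
  by rewrite hc mulNr mulrN mulrA subrr scale0r.
(* The pairing leaves over the last two [U] and the first two [V], which vanish separately. *)
have U0 j : (k - j <= 1)%N -> U j = 0.
  move=> kj; rewrite /U /h; case: (k - j)%N kj => [|[|]]//= _;
    by rewrite mul0n mulr0 scale0r.
have V0 : V 0%N = 0 by rewrite /V mul0n mul0r mulr0 scale0r.
have V1 : V 1%N = 0 by rewrite /V muln0 mul0r mulr0 scale0r.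
rewrite big_split/=.
have [k1|k1] := leqP k 1.
  rewrite !big1 ?addr0// => -[j jk] _ /=; last first.
    by apply: U0; exact: leq_trans (leq_subr _ _) k1.
  case: j jk => [|[|j]] //= jk.
  by have := leq_trans jk (k1 : (k.+1 <= 2)%N).
move: k1; case E: k => [|[|k']] // _.
rewrite big_ord_recr big_ord_recr/= U0 ?addr0; last by rewrite E subSnn.
rewrite (U0 k'.+2) ?E ?subnn// addr0.
rewrite [X in _ + X]big_ord_recl [X in _ + (_ + X)]big_ord_recl /=.
rewrite V0 V1 !add0r.
rewrite -big_split/= big1// => j _.
by rewrite UV// E !ltnS -ltnS.
Qed.

(* Only the term [j = k] of [zonal x] contributes: the others are divisible by
   [normsq], hence orthogonal to harmonic polynomials. *)
Lemma fischer_zonal x y :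
  fischer k (zonal x) (zonal y) = c k * (k`! ^ 2)%:R * zonalker x y.
Proof.
rewrite {1}/zonal fischer_suml big_ord_recr/= big1 ?add0r => [|j _].
  rewrite subnn !expr0 mulr1 mul1r fischerZl fischerC reproduced_zonal.
  by rewrite meval_zonal mulrA.
have jk : (j < k)%N := ltn_ord j.
have [o|e] := boolP (odd (k - j)).
  by rewrite c_odd ?(ltnW jk)// mul0r scale0r fischerC linear0.
have k2 : (2 <= k - j)%N.
  by move: jk; rewrite -subn_gt0; case: (k - j)%N e => [|[|]].
have : (0 < (k - j)./2)%N by rewrite half_gt0.
case: _./2 => // a _.
rewrite fischerZl [normsq ^+ _]exprS -[normsq * _ * _]mulrA.
rewrite fischer_normsqM_harmonic ?laplacian_zonal ?mulr0//.
by rewrite (leq_trans k2)// leq_subr.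
Qed.

Lemma zonalker_psd (I : Type) (s : seq I) (w : I -> R) (v : I -> 'I_m -> R) :
  0 < c k -> 0 <= \sum_(i <- s) \sum_(j <- s) w i * w j * zonalker (v i) (v j).
Proof.
move=> ck; pose z := \sum_(i <- s) w i *: zonal (v i).
have d0 : 0 < c k * (k`! ^ 2)%:R by rewrite mulr_gt0// ltr0n expn_gt0 fact_gt0.
rewrite -(pmulr_rge0 _ d0); have := fischer_ge0 k z; congr (0 <= _).
rewrite {1}/z fischer_suml mulr_sumr; apply: eq_bigr => i _.
rewrite fischerZl linear_sum/= !mulr_sumr; apply: eq_bigr => j _.
by rewrite linearZ/= fischer_zonal; ring.
Qed.

(** A Fischer square again. At a unit vector, it turns the normalization [P(1) = 1] into the sign of
    the leading coefficient. *)
Lemma lead_zonal_ge0 x : 0 <= c k * zonalker x x.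
Proof.
have f0 : 0 < (k`! ^ 2)%:R :> R by rewrite ltr0n expn_gt0 fact_gt0.
rewrite -(pmulr_rge0 _ f0) mulrA [_ * c k]mulrC -fischer_zonal.
exact: fischer_ge0.
Qed.
End zonal.

End fischer.

From mathcomp Require Import finmap.
From mathcomp Require Import all_classical all_reals all_analysis.
From mathcomp Require Import measurable_realfun.

Import numFieldNormedType.Exports.

Local Open Scope classical_set_scope.
Local Open Scope ring_scope.

(** * The Gegenbauer weight *)

Section ftc_integrable.
Variable R : realType.
Notation mu := (@lebesgue_measure R).

(** The integrand may blow up at the endpoints. [F] minus the parametrized integral of [f] is
    continuous on the closed interval and has zero derivative inside, so the mean value theorem
    makes its endpoint values equal. *)
Lemma integrable_FTC2 (f F : R -> R) (a b : R) : a < b ->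
  mu.-integrable `[a, b] (EFin \o f) ->
  {within `[a, b], continuous F} ->
  (forall x, x \in `]a, b[ -> is_derive x 1 F (f x)) ->
  {in `]a, b[, continuous f} ->
  \int[mu]_(x in `[a, b]) f x = F b - F a.
Proof.
move=> ab fi cF dF cf.
pose G x := \int[mu]_(t in `[a, x]) f t.
have cG : {within `[a, b], continuous G}.
  exact: parameterized_integral_continuous (ltW ab) fi.
have dFG x : x \in `]a, b[ -> is_derive x 1 (F - G) ((fun=> 0) x).
  move=> xab; have := xab; rewrite in_itv/= => /andP[ax xb].
  have [dG G'] := continuous_FTC1_closed xb fi ax (cf x xab).
  have dGx : is_derive x 1 G (f x).
    by apply: DeriveDef => //; rewrite -derive1E.
  have := dF x xab => dFx.
  by apply: is_derive_eq; rewrite subrr.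
have cFG : {within `[a, b], continuous (F - G)}.
  by move=> x; apply: cvgB; [exact: cF|exact: cG].
have [c _] := MVT ab dFG cFG.
rewrite mul0r !fctE {2}/G set_itv1 Rintegral_set1 subr0 => /eqP.
by rewrite addrAC subr_eq0 eq_sym => /eqP.
Qed.
End ftc_integrable.

(** * Integrability of the inverse square root of [1 - t^2] *)

Section weight.
Variable R : realType.
Notation mu := (@lebesgue_measure R).
Implicit Types t : R.

Definition rho t : R := Num.sqrt (1 - t ^+ 2).

Lemma onemsqr_gt0 t : t \in `]-1, 1[ -> 0 < 1 - t ^+ 2.
Proof. by rewrite in_itv/= => /andP[]; nra. Qed.

Lemma rho_gt0 t : t \in `]-1, 1[ -> 0 < rho t.
Proof. by move=> /onemsqr_gt0; rewrite sqrtr_gt0. Qed.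

Lemma sqr_rho t : t \in `]-1, 1[ -> rho t ^+ 2 = 1 - t ^+ 2.
Proof. by move=> /onemsqr_gt0/ltW; exact: sqr_sqrtr. Qed.

Lemma continuous_rho : continuous rho.
Proof.
move=> t; apply: (@continuous_comp _ _ _ (fun t : R => 1 - t ^+ 2) Num.sqrt).
  by apply: continuousB; [exact: cst_continuous|exact: exprn_continuous].
exact: sqrt_continuous.
Qed.

Lemma is_derive_rho t : t \in `]-1, 1[ -> is_derive t 1 rho (- t / rho t).
Proof.
move=> t1; have h0 := onemsqr_gt0 t1; have r0 := rho_gt0 t1.
have d1 : is_derive t 1 (fun t : R => 1 - t ^+ 2) (- (2 * t)).
  apply: is_derive_eq; rewrite /GRing.scale/=; ring.
have d2 := @is_derive1_sqrt R _ h0.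
have := @is_derive1_comp _ Num.sqrt (fun t => 1 - t ^+ 2) _ _ _ d2 d1.
rewrite /comp => d; apply: is_derive_eq.
by rewrite /rho; field; rewrite gt_eqF.
Qed.

Lemma is_derive_rhoX n t : t \in `]-1, 1[ ->
  is_derive t 1 (fun t => rho t ^+ n.+1) (- (n.+1%:R * t * rho t ^+ n / rho t)).
Proof.
move=> t1; have := is_derive_rho t1 => d.
rewrite (_ : (fun _ => _) = rho ^+ n.+1); last first.
  by apply/funext => x; rewrite !fctE.
apply: is_derive_eq; by rewrite /GRing.scale/=; ring.
Qed.

Lemma continuous_invrho : {in `]-1, 1[, continuous (fun t => (rho t)^-1)}.
Proof.
move=> t t1; apply: continuousV; last exact: continuous_rho.
by rewrite gt_eqF// rho_gt0.
Qed.


Lemma measurable_invrho : measurable_fun `[(-1), (1 : R)] (fun t => (rho t)^-1).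
Proof.
apply: (eq_measurable_fun (fun t : R => (1 - t ^+ 2) `^ (- 2^-1))).
  move=> t; rewrite inE/= in_itv/= => /andP[t1 t2].
  have h0 : 0 <= 1 - t ^+ 2 by nra.
  by rewrite powRN powR12_sqrt.
apply: measurable_funTS.
apply: (measurableT_comp (measurable_powR _)).
by apply: measurable_funB => //; exact: measurable_funX.
Qed.

(** The antiderivative is [asin], with values between [- pi / 2] and [pi / 2]. What matters is that
    the bound does not depend on [a] and [b]. *)
Lemma integral_invrho_le (a b : R) : -1 < a -> a < b -> b < 1 ->
  (\int[mu]_(t in `[a, b]) ((rho t)^-1)%:E <= (2 * pi)%:E)%E.
Proof.
move=> a1 ab b1.
have sub x : a <= x <= b -> -1 < x < 1.
  by move=> /andP[? ?]; apply/andP; split; lra.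
have dasin x : a <= x <= b -> is_derive x 1 (@asin R) (rho x)^-1.
  by move=> /sub; exact: is_derive1_asin.
have casin x : a <= x <= b -> {for x, continuous (@asin R)}.
  by move=> /sub; exact: continuous_asin.
have iab x : x \in `]a, b[ -> a <= x <= b.
  by rewrite in_itv/= => /andP[? ?]; apply/andP; split; lra.
rewrite (@continuous_FTC2 R _ asin a b)//.
- rewrite -EFinB lee_fin.
  have [aa bb] : (-1 <= a <= 1) /\ (-1 <= b <= 1).
    by split; apply/andP; split; lra.
  have := asin_lepi2 bb; have := asin_geNpi2 aa; have := pi_gt0 R.
  by lra.
- apply: continuous_in_subspaceT => x; rewrite inE/= => xab.
  apply: continuous_invrho; rewrite in_itv/=; apply: sub.
  by move: xab; rewrite in_itv.
- split.
  + by move=> x /iab /dasin.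
  + by apply: cvg_at_right_filter; apply: casin; rewrite lexx ltW.
  + by apply: cvg_at_left_filter; apply: casin; rewrite lexx ltW.
- by move=> x /iab /dasin h; rewrite derive1E derive_val.
Qed.

Lemma integrable_invrho :
  mu.-integrable `[(-1), (1 : R)] (EFin \o (fun t => (rho t)^-1)).
Proof.
apply/integrableP; split.
  by apply/measurable_EFinP; exact: measurable_invrho.
have mo : measurable_fun `](-1), (1 : R)[ (fun t => (rho t)^-1).
  by apply: measurable_funS measurable_invrho => //; exact: subset_itv_oo_cc.
have r0 t : 0 <= (rho t)^-1 by rewrite invr_ge0 sqrtr_ge0.
under eq_integral do rewrite /= ger0_norm//.
rewrite integral_itv_bndoo; last exact/measurable_EFinP.
(* Monotone convergence along closed intervals exhausting the open one; [n.+2] keeps each of them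
   nondegenerate. *)
pose F n : set R := `[-1 + n.+2%:R^-1, 1 - n.+2%:R^-1]%classic.
have FE : `](-1), (1 : R)[%classic = \bigcup_n F n.
  apply/seteqP; split => [t/=|t [n _]].
    rewrite in_itv/= => /andP[t1 t2].
    have t3 : 0 < 1 - `|t|.
      by rewrite subr_gt0 ltr_norml t1.
    exists (Num.trunc (1 - `|t|)^-1) => //=; rewrite /F/= in_itv/=.
    set n := Num.trunc _.
    have hn0 : 0 <= (1 - `|t|)^-1 by rewrite invr_ge0 ltW.
    have /andP[_ hn] := truncn_itv hn0.
    have : n.+2%:R^-1 <= 1 - `|t|.
      rewrite -[leRHS]invrK lef_pV2 ?posrE ?invr_gt0//.
      by rewrite (le_trans (ltW hn))// ler_nat.
    move: (n.+2%:R^-1) => e.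
    rewrite lerBrDr addrC -lerBrDr ler_norml => /andP[? ?].
    by apply/andP; split; lra.
  have : 0 < n.+2%:R^-1 :> R by rewrite invr_gt0.
  rewrite /F/= !in_itv/=; move: (n.+2%:R^-1) => e e0 /andP[t1 t2].
  by apply/andP; split; lra.
rewrite FE.
have n2 n : n.+2%:R^-1 <= 2^-1 :> R by rewrite lef_pV2 ?posrE// ler_nat.
have n0 n : 0 < n.+2%:R^-1 :> R by rewrite invr_gt0.
have mF n : measurable_fun (F n) (EFin \o (fun t => (rho t)^-1)).
  apply/measurable_EFinP; apply: measurable_funS mo => //.
  by rewrite FE; exact: bigcup_sup.
have h : (\int[mu]_(x in F i) ((rho x)^-1)%:E @[i --> \oo] -->
    \int[mu]_(x in \bigcup_i F i) ((rho x)^-1)%:E)%E.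
  apply: ge0_nondecreasing_set_cvg_integral => //.
  - move=> m n mn; rewrite subsetEset /F; apply: subset_itv; rewrite bnd_simp.
      by rewrite lerD2l lef_pV2 ?posrE// ler_nat.
    by rewrite lerD2l lerN2 lef_pV2 ?posrE// ler_nat.
  - by move=> n; exact: measurable_itv.
  - by move=> n t _; rewrite lee_fin.
rewrite -(cvg_lim _ h)//.
apply: (@le_lt_trans _ _ (2 * pi)%:E); last exact: ltry.
apply: lime_le; first by exact: cvgP h.
apply: nearW => n; apply: integral_invrho_le.
- by rewrite ltrDl.
- by have := n2 n; have := n0 n; move: (n.+2%:R^-1) => e e1 e2; lra.
- by rewrite gtrDl oppr_lt0.
Qed.
End weight.

(** * The weighted integral as a linear form on polynomials *)

Section functional.
Variable R : realType.
Variable p : nat.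
Notation mu := (@lebesgue_measure R).
Implicit Types (t : R) (q : {poly R}).

(* The weight of dimension [m = p + 2]: [rho t ^+ p / rho t] is
   [(1 - t ^+ 2) `^ ((m - 3) / 2)] up to the values at [t = -1] and [t = 1]. *)
Definition gegint q : R :=
  \int[mu]_(t in `[(-1), 1]) (q.[t] * (rho t ^+ p / rho t)).

Lemma continuous_rhoX n : continuous (fun t => rho t ^+ n).
Proof.
move=> t; apply: (@continuous_comp _ _ _ (@rho R) (fun x => x ^+ n)).
  exact: continuous_rho.
exact: exprn_continuous.
Qed.

(** A continuous, hence bounded, factor times the integrable [(rho t)^-1]. This includes [p = 0],
    where the weight is unbounded. *)
Lemma integrable_gegint q : mu.-integrable `[(-1), (1 : R)]
  (EFin \o (fun t => q.[t] * (rho t ^+ p / rho t))).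
Proof.
pose h t := q.[t] * rho t ^+ p.
have ch : continuous h.
  move=> t; apply: continuousM; first exact: continuous_horner.
  exact: continuous_rhoX.
rewrite (_ : EFin \o _ = (EFin \o h) \* (EFin \o (fun t => ((rho t)^-1)%R)))%E.
  apply: integrableMr => //.
  - by apply: measurable_funTS; exact: continuous_measurable_fun.
  - have /(continuous_compact (continuous_subspaceT ch))/compact_bounded :=
      @segment_compact R (-1) 1.
    case=> M [_ hM]; exists M; split; rewrite ?num_real// => ? ? ? ?.
    exact: hM.
  - exact: integrable_invrho.
by apply/funext => t /=; rewrite -EFinM /h !mulrA.
Qed.

Lemma gegint_is_linear : scalar gegint.
Proof.
move=> a q1 q2; rewrite -[RHS]/(a * gegint q1 + gegint q2) /gegint.
have i1 := integrable_gegint q1; have i2 := integrable_gegint q2.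
have i3 : mu.-integrable `[(-1), (1 : R)]
    (EFin \o (fun t => a * (q1.[t] * (rho t ^+ p / rho t)))).
  have := integrable_gegint (a *: q1).
  rewrite (_ : (fun t => (a *: q1).[t] * _) =
    (fun x => a * (q1.[x] * (rho x ^+ p / rho x))))//.
  by apply/funext => t /=; rewrite hornerZ mulrA.
rewrite -RintegralZl// -RintegralD//.
by apply: eq_Rintegral => t _; rewrite hornerD hornerZ mulrDl !mulrA.
Qed.
HB.instance Definition _ :=
  GRing.isLinear.Build R {poly R} R _ gegint gegint_is_linear.

(** The integrand is the derivative of [rho t ^+ p.+1 * q.[t]], which vanishes at both endpoints. *)
Lemma gegint_deriv q :
  gegint ((1 - 'X^2) * q^`() - p.+1%:R *: ('X * q)) = 0.
Proof.
pose H t := rho t ^+ p.+1 * q.[t].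
have cH : continuous H.
  move=> t.
  exact: continuousM (@continuous_rhoX _ _) (@continuous_horner _ _ _).
transitivity (H 1 - H (-1)); last first.
  by rewrite /H /rho sqrrN expr1n subrr sqrtr0 expr0n/= !mul0r subrr.
apply: integrable_FTC2.
- by rewrite gtrN.
- exact: integrable_gegint.
- exact: continuous_subspaceT cH.
- move=> t t1; have dr := is_derive_rhoX p t1; have dq := is_derive_poly q t.
  have r0 := rho_gt0 t1.
  apply: is_derive_eq; rewrite /GRing.scale/=.
  rewrite !(hornerD, hornerN, hornerM, hornerZ, hornerC, hornerXn, hornerX).
  rewrite -(sqr_rho t1) exprS.
  by field; rewrite gt_eqF.
- move=> t t1; apply: continuousM; first exact: continuous_horner.
  apply: continuousM; last exact: continuous_invrho.
  exact: continuous_rhoX.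
Qed.


(** A nonnegative integrand with zero integral vanishes almost everywhere. As the weight is positive
    inside, a nonzero [q] would leave the open interval covered by a null set and finitely many
    roots. *)
Lemma gegint_sqr_eq0 q : gegint (q ^+ 2) = 0 -> q = 0.
Proof.
move=> q0; apply/eqP/negPn/negP => qn0.
pose f t := (q ^+ 2).[t] * (rho t ^+ p / rho t).
have f0 t : 0 <= f t.
  rewrite /f horner_exp mulr_ge0 ?sqr_ge0// divr_ge0 ?exprn_ge0// sqrtr_ge0//.
have fi : mu.-integrable `[(-1), (1 : R)] (EFin \o f) := integrable_gegint _.
have mf : measurable_fun `[(-1), (1 : R)] (EFin \o f) by case/integrableP: fi.
have fae : ae_eq mu `[(-1), (1 : R)]%classic (EFin \o f) (cst 0%E).
  apply/(ae_eq_integral_abs mu _ mf) => //.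
  under eq_integral => t _ do rewrite /= ger0_norm//.
  rewrite -[LHS]fineK; first by rewrite [fine _]q0.
  exact: integrable_fin_num.
have : mu `](-1), (1 : R)[%classic = 0%E.
  have [N [mN N0 sN]] := fae.
  apply/eqP; rewrite -measure_le0.
  pose Z := [set t | root q t].
  have fZ : finite_set Z.
    apply: contrapT => /(infinite_set_fset (size q))[X XZ szX].
    have /max_poly_roots := qn0 => /(_ (enum_fset X)) h.
    have : (size (enum_fset X) < size q)%N.
      by apply: h; [apply/allP => x xX; exact: XZ|exact: fset_uniq].
    by rewrite ltnNge szX.
  have cZ : countable Z by exact: finite_set_countable.
  have mZ : measurable Z by exact: countable_measurable.
  have Z0 : mu Z = 0%E by exact: countable_lebesgue_measure0.
  apply: (@le_trans _ _ (mu (N `|` Z))).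
    apply: le_measure => //; rewrite ?inE//; first exact: measurableU.
    move=> t/= t1; have [qt|qt] := boolP (root q t); [by right|left].
    apply: sN => /=; rewrite in_itv/= => h.
    have r0 := rho_gt0 t1.
    have : f t = 0.
      have /h : -1 <= t <= 1.
        by move: t1; rewrite in_itv/= => /andP[/ltW -> /ltW ->].
      by case.
    move/eqP; rewrite /f horner_exp !mulf_eq0 !expf_eq0 invr_eq0 (gt_eqF r0).
    rewrite andbF !orbF orbb.
    by rewrite -rootE (negbTE qt).
  apply: (le_trans (measureU2 _ mN mZ)).
  by rewrite [X in (X + _)%E]N0 [X in (_ + X)%E]Z0 adde0.
rewrite lebesgue_measure_itv/= lte_fin gtrN// => /eqP.
by rewrite -EFinB eqe opprK gt_eqF.
Qed.

(** The two weights can differ at the endpoints: for [p = 1] they are there [1] and [0]. Both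
    integrals are therefore first reduced to the open interval. *)
Lemma gegintE (q : {poly R}) :
  \int[mu]_(t in `[(-1), 1]) (q.[t] * (1 - t ^+ 2) `^ ((p.+2%:R - 3) / 2)) =
  gegint q.
Proof.
have weightE t : t \in `]-1, 1[ ->
    (1 - t ^+ 2) `^ ((p.+2%:R - 3) / 2) = rho t ^+ p / rho t.
  move=> t1; have h0 := onemsqr_gt0 t1; have r0 := rho_gt0 t1.
  rewrite (_ : (p.+2%:R - 3) / 2 = 2^-1 * p%:R + - 2^-1 :> R); last first.
    by rewrite -addn2 natrD; field.
  rewrite powRD; last by rewrite (lt0r_neq0 h0) implybT.
  rewrite powRrM powR12_sqrt ?ltW// powR_mulrn ?sqrtr_ge0//.
  by rewrite powRN powR12_sqrt ?ltW.
rewrite /gegint /Rintegral; congr fine.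
rewrite integral_itv_bndoo; last first.
  apply/measurable_EFinP; apply: measurable_funTS; apply: measurable_funM.
    by apply: continuous_measurable_fun; exact: continuous_horner.
  apply: (measurableT_comp (measurable_powR _)).
  by apply: measurable_funB => //; exact: measurable_funX.
rewrite [RHS]integral_itv_bndoo; last first.
  have /integrableP[mq _] := integrable_gegint q.
  by apply: measurable_funS mq => //; exact: subset_itv_oo_cc.
by apply: eq_integral => t; rewrite inE/= => t1; rewrite weightE.
Qed.
End functional.

(** * The Gegenbauer differential equation *)

Section gegenbauer_operator.
Variables (R : realType) (p : nat).
Implicit Types (q r : {poly R}).

Definition gegop q : {poly R} :=
  (1 - 'X^2) * q^`()^`() - p.+1%:R *: ('X * q^`()).

Lemma coef_gegop q i :
  (gegop q)`_i = (i.+2 * i.+1)%:R * q`_i.+2 - (i * (i + p))%:R * q`_i.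
Proof.
rewrite /gegop coefB coefZ coefXM mulrBl mul1r coefB coefXnM !coef_deriv.
case: i => [|[|i]] /=; rewrite ?subn2 ?natrM.
- ring.
- ring.
- ring.
Qed.

(** Integration by parts gives minus the integral of [(1 - 'X^2) * q^]() * r^[()], which is
    symmetric in [q] and [r]. *)
Lemma gegop_adjoint q r : gegint p (gegop q * r) = gegint p (q * gegop r).
Proof.
have key q1 r1 :
    gegint p (gegop q1 * r1) = - gegint p ((1 - 'X^2) * q1^`() * r1^`()).
  apply/eqP; rewrite -addr_eq0 -linearD/=.
  rewrite -[X in _ == X](gegint_deriv p (q1^`() * r1)).
  apply/eqP; congr gegint; rewrite /gegop derivM -!mul_polyC; ring.
by rewrite key [q * _]mulrC key mulrAC.
Qed.

Lemma size_gegop q : (size (gegop q) <= size q)%N.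
Proof.
apply/leq_sizeP => i qi; rewrite coef_gegop !nth_default ?mulr0 ?subrr//.
by rewrite (leq_trans qi)// -addn2 leq_addr.
Qed.

(** * Consequences of orthogonality: eigenvalue equation, recursion and parity *)

Section family.
Variable P : nat -> {poly R}.
Hypothesis PP : is_gegenbauer p.+2 P.

Let szP k : size (P k) = k.+1. Proof. by case: PP. Qed.

Lemma gegint_orth j k : j != k -> gegint p (P j * P k) = 0.
Proof.
move=> jk; case: PP => _ _ /(_ _ _ jk) <-; rewrite -gegintE.
by apply: eq_Rintegral => t _; rewrite hornerM.
Qed.

(** Induction on the size of [q]: subtracting a multiple of the [P d] of the same degree lowers the
    degree. *)
Lemma gegint_orth_low k q : (size q <= k)%N -> gegint p (P k * q) = 0.
Proof.
have [n] := ubnP (size q); elim: n => // n IH in q *; rewrite ltnS => qn qk.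
have [->|q0] := eqVneq q 0; first by rewrite mulr0 linear0.
pose d := (size q).-1.
have sq : size q = d.+1 by rewrite prednK// size_poly_gt0.
pose c := lead_coef q / lead_coef (P d).
have lP : lead_coef (P d) != 0 by rewrite lead_coef_eq0 -size_poly_eq0 szP.
have sr : (size (q - c *: P d)%R <= d)%N.
  apply/leq_sizeP => i; rewrite leq_eqVlt => /predU1P[<-|di].
    rewrite coefB coefZ -[q`_d]/(lead_coef q).
    have -> : (P d)`_d = lead_coef (P d) by rewrite lead_coefE szP.
    by rewrite /c divfK// subrr.
  by rewrite coefB coefZ !nth_default ?mulr0 ?subrr ?szP ?sq.
have srn : (size (q - c *: P d)%R < n)%N by rewrite (leq_ltn_trans sr) -?sq.
have srk : (size (q - c *: P d)%R <= k)%N.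
  by apply: (leq_trans sr); apply: ltnW; rewrite -sq.
rewrite -[q](subrK (c *: P d)) mulrDr linearD/= (IH _ srn srk) add0r.
rewrite -scalerAr linearZ/= gegint_orth ?mulr0//.
by rewrite eq_sym neq_ltn -sq qk.
Qed.

(** The leading terms cancel in [e], so [e] and [gegop e] have degree below [k] and are orthogonal
    to [P k]. Self-adjointness then makes [e] orthogonal to itself. *)
Lemma gegop_eigen k : gegop (P k) = - (k * (k + p))%:R *: P k.
Proof.
pose e := gegop (P k) + (k * (k + p))%:R *: P k.
suff: e = 0 by move/eqP; rewrite addr_eq0 scaleNr => /eqP.
have se : (size e <= k)%N.
  apply/leq_sizeP => i; rewrite leq_eqVlt => /predU1P[<-|ki].
    rewrite coefD coefZ coef_gegop [(P k)`_k.+2]nth_default ?szP//.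
    by rewrite mulr0 add0r addNr.
  rewrite coefD coefZ coef_gegop !nth_default ?szP// ?mulr0 ?subrr ?addr0//.
  by rewrite ltnS ltnW// ltnS ltnW.
apply: (@gegint_sqr_eq0 _ p); rewrite expr2 {1}/e mulrDl linearD/=.
rewrite -scalerAl linearZ/= gegop_adjoint !gegint_orth_low ?mulr0 ?addr0//.
exact: leq_trans (size_gegop _) se.
Qed.

Lemma gegenbauer_coef_rec k i : (i <= k)%N ->
  (i.+2 * i.+1)%:R * (P k)`_i.+2 = - ((k - i) * (k + i + p))%:R * (P k)`_i.
Proof.
move=> ik; have := congr1 (fun q : {poly R} => q`_i) (gegop_eigen k).
rewrite /= coef_gegop coefZ => /eqP; rewrite subr_eq => /eqP ->.
rewrite -mulrDl; congr (_ * _); rewrite !natrM natrB// !natrD; ring.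
Qed.

(** Downward induction in steps of two, starting from the zero coefficient of index [k + 1]. The
    factor [(k - i) * (k + i + p)] of the recursion is nonzero for [i < k]. *)
Lemma gegenbauer_coef_odd k i : (i <= k)%N -> odd (k - i) -> (P k)`_i = 0.
Proof.
move: i; suff H d : (d <= k)%N -> odd d -> (P k)`_(k - d) = 0.
  by move=> i ik oik; rewrite -(subKn ik) H// leq_subr.
have [n] := ubnP d; elim: n => // n IH in d *; rewrite ltnS => dn dk od.
have d0 : (0 < d)%N by case: d od {dn dk}.
have := @gegenbauer_coef_rec k (k - d) (leq_subr _ _).
have -> : (P k)`_(k - d).+2 = 0.
  case: d d0 od dn dk => [|[|d]]//= _ od dn dk.
    by rewrite nth_default// szP subn1 prednK.
  rewrite (_ : (k - d.+2).+2 = k - d)%N; last by rewrite -addn2 -subnA// subn2.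
  apply: IH; [exact: ltnW| |by rewrite negbK in od].
  exact: leq_trans (leqnSn _) (ltnW dk).
rewrite mulr0 => /esym/eqP.
rewrite mulf_eq0 oppr_eq0 pnatr_eq0 muln_eq0 subKn//.
rewrite (gtn_eqF d0)/= => /orP[|/eqP//].
by rewrite !addn_eq0 (gtn_eqF (leq_trans d0 dk)).
Qed.

End family.
End gegenbauer_operator.

(** * Positive semidefiniteness on the sphere *)

Section dotp.
Variables (R : realType) (n : nat).
Implicit Types (x y z : 'rV[R]_n) (a : R).

Lemma dotpC x y : dotp x y = dotp y x.
Proof. by apply: eq_bigr => i _; rewrite mulrC. Qed.

Lemma dotpDl x y z : dotp (x + y) z = dotp x z + dotp y z.
Proof. by rewrite -big_split; apply: eq_bigr => i _; rewrite mxE mulrDl. Qed.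

Lemma dotpZl a x y : dotp (a *: x) y = a * dotp x y.
Proof.
by rewrite /dotp mulr_sumr; apply: eq_bigr => i _; rewrite mxE mulrA.
Qed.

Lemma dotpDr x y z : dotp x (y + z) = dotp x y + dotp x z.
Proof. by rewrite !(dotpC x) dotpDl. Qed.

Lemma dotpZr a x y : dotp x (a *: y) = a * dotp x y.
Proof. by rewrite !(dotpC x) dotpZl. Qed.

Lemma dotpNl x y : dotp (- x) y = - dotp x y.
Proof. by rewrite -scaleN1r dotpZl mulN1r. Qed.

Lemma dotpNr x y : dotp x (- y) = - dotp x y.
Proof. by rewrite !(dotpC x) dotpNl. Qed.

Definition dotpE := (dotpDl, dotpDr, dotpNl, dotpNr, dotpZl, dotpZr).

Lemma dotp_ge0 x : 0 <= dotp x x.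
Proof. by apply: sumr_ge0 => i _; exact: sqr_ge0. Qed.

Lemma dotp_eq0 x : dotp x x = 0 -> x = 0.
Proof.
move=> /eqP; rewrite psumr_eq0 => [/allP x0|i _]; last exact: sqr_ge0.
apply/rowP => i; rewrite mxE; apply/eqP; rewrite -[_ == 0]orbb -mulf_eq0.
exact: x0 (mem_index_enum i).
Qed.

Lemma dotp_cauchy_schwarz x y : dotp x y ^+ 2 <= dotp x x * dotp y y.
Proof.
have [y0|y0] := eqVneq (dotp y y) 0.
  by rewrite (dotp_eq0 y0) -(scale0r 0) !dotpZr !mul0r expr0n mulr0.
have yy : 0 < dotp y y by rewrite lt_def y0 dotp_ge0.
rewrite -subr_ge0 -(pmulr_rge0 _ yy).
have := dotp_ge0 (dotp y y *: x - dotp x y *: y); congr (0 <= _).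
by rewrite !dotpE (dotpC y x); ring.
Qed.

(** Cauchy-Schwarz for the projections of [y] and [z] on the orthogonal complement of [x]. *)
Lemma gram3_ge0 x y z : dotp x x = 1 -> dotp y y = 1 -> dotp z z = 1 ->
  0 <= 1 + 2 * dotp x y * dotp x z * dotp y z
       - dotp x y ^+ 2 - dotp x z ^+ 2 - dotp y z ^+ 2.
Proof.
move=> x1 y1 z1.
have := dotp_cauchy_schwarz (y - dotp x y *: x) (z - dotp x z *: x).
rewrite !dotpE x1 y1 z1 !(dotpC _ x) -subr_ge0; congr (0 <= _).
by ring.
Qed.

Lemma dotp_unit_itv x y : dotp x x = 1 -> dotp y y = 1 -> x != y ->
  -1 <= dotp x y < 1.
Proof.
move=> x1 y1 xy.
have hp := dotp_ge0 (x + y); have hm := dotp_ge0 (x - y).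
have : dotp (x - y) (x - y) != 0.
  by apply: contra xy => /eqP /dotp_eq0 /eqP; rewrite subr_eq0.
rewrite !dotpE x1 y1 (dotpC y x) in hp hm *.
move: (dotp x y) hp hm => a hp hm a1; apply/andP; split; first lra.
rewrite lt_def; apply/andP; split; last lra.
by apply: contra a1 => /eqP <-; apply/eqP; ring.
Qed.
End dotp.

(** * Coordinates on the orthogonal complement of a unit vector *)

Section householder.
Variables (R : realType) (m : nat) (z : 'rV[R]_m.+1).
Hypothesis z1 : dotp z z = 1.
Implicit Types x y : 'rV[R]_m.+1.

Let e0 : 'rV[R]_m.+1 := delta_mx 0 0.
Let v := z - e0.

Let dotp_e0 x : dotp x e0 = x 0 0.
Proof.
rewrite /dotp (bigD1 0)//= big1 ?addr0 => [|i i0].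
  by rewrite mxE !eqxx mulr1.
by rewrite mxE (negbTE i0) andbF mulr0.
Qed.

(* The reflection exchanging [z] and [e0]. When [z = e0], the division by [0]
   yields [0], so that this is the identity. *)
Definition householder x := x - (dotp x v / (1 - z 0 0)) *: v.

Lemma dotp_householder x y : dotp (householder x) (householder y) = dotp x y.
Proof.
have vv : dotp v v = 2 * (1 - z 0 0).
  by rewrite /v !dotpE z1 dotp_e0 (dotpC e0) !dotp_e0 mxE !eqxx /=; ring.
rewrite /householder; move: (v) vv => u uu; rewrite !dotpE uu (dotpC u y).
have [->|c0] := eqVneq (1 - z 0 0) 0; first by rewrite invr0; ring.
by field.
Qed.

Lemma householder0 x : householder x 0 0 = dotp x z.
Proof.
have vv : dotp v v = 2 * (1 - z 0 0).
  by rewrite /v !dotpE z1 dotp_e0 (dotpC e0) !dotp_e0 mxE !eqxx /=; ring.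
rewrite /householder !mxE !eqxx /=.
have [c0|c0] := eqVneq (1 - z 0 0) 0.
  have v0 : v = 0 by apply: dotp_eq0; rewrite vv c0 mulr0.
  rewrite c0 invr0 mulr0 mul0r subr0.
  by rewrite -[z](subrK e0) -/v v0 add0r dotp_e0.
by rewrite /v dotpDr dotpNr dotp_e0; field.
Qed.

(** The reflection maps [z] to [e0], so the coordinates other than the first are those of the
    projection of [x] orthogonal to [z]. *)
Definition orthcoord x (i : 'I_m) : R := householder x 0 (lift 0 i).

Lemma dotf_orthcoord x y :
  dotf (orthcoord x) (orthcoord y) = dotp x y - dotp x z * dotp y z.
Proof.
rewrite -(dotp_householder x y) -!householder0 /dotp big_ord_recl.
by rewrite addrAC subrr add0r.
Qed.
End householder.

(** * The Bachoc-Vallentin inequality for a fixed pole *)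

Section Qker.
Variable R : realType.

(** The alternative is the default value of [xget], the zero family, for which every kernel
    vanishes. *)
Lemma gegenbauerP m :
  is_gegenbauer m (gegenbauer R m) \/ forall k, gegenbauer R m k = 0.
Proof. by rewrite /gegenbauer; case: xgetP => [P ->|_]; [left|right]. Qed.

(** At this point [t - u * v] and the square root are both 0, so only [k = 0] leaves a term. The
    inequality also covers the zero family. *)
Lemma Qker_diag_le n k : Qker n k 1 1 1 <= (k == 0%N)%:R :> R.
Proof.
rewrite /Qker !mulr1 !expr1n !subrr mul0r sqrtr0.
case: k => [|k]; last first.
  rewrite big1// => -[l lk] _ /=; rewrite !expr0n -mulrA -natrM mulnb subn_eq0.
  by case: l lk => [|l] lk /=; rewrite mulr0.
rewrite big_ord1 !expr0 !mulr1/=.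
have [[sP P1 _]|->] := gegenbauerP n.-1; last by rewrite coef0.
have /size_poly1P[c _ Pc] : size (gegenbauer R n.-1 0) == 1%N by rewrite sP.
by have := P1 0%N; rewrite Pc hornerC coefC => ->.
Qed.

(** By [dotf_orthcoord], the projections orthogonal to [z] have inner products
    [<x, y> - <x, z> <y, z>]. This identifies [Qker] with [zonalker] in dimension [n - 1]. *)
Lemma Qker_psd n k (I : Type) (s : seq I) (w : I -> R) (x : I -> 'rV[R]_n)
    (z : 'rV[R]_n) :
  (3 <= n)%N -> dotp z z = 1 -> (forall i, dotp (x i) (x i) = 1) ->
  0 <= \sum_(i <- s) \sum_(j <- s)
    w i * w j * Qker n k (dotp (x i) z) (dotp (x j) z) (dotp (x i) (x j)).
Proof.
case: n x z => [|[|[|p]]]// x z _ z1 x1.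
have [PP|P0] := gegenbauerP p.+2; last first.
  rewrite big1// => i _; rewrite big1// => j _.
  by rewrite /Qker big1 ?mulr0// => l _; rewrite P0 coef0 !mul0r.
pose c i := (gegenbauer R p.+2 k)`_i.
have c_rec i : (i <= k)%N ->
    (i.+2 * i.+1)%:R * c i.+2 = - ((k - i) * (k + i + p))%:R * c i.
  exact: (gegenbauer_coef_rec PP).
have c_odd i : (i <= k)%N -> odd (k - i) -> c i = 0.
  exact: (gegenbauer_coef_odd PP).
have QE i j : Qker p.+3 k (dotp (x i) z) (dotp (x j) z) (dotp (x i) (x j)) =
    zonalker k c (orthcoord z (x i)) (orthcoord z (x j)).
  rewrite /Qker /zonalker !dotf_orthcoord// !x1 -!expr2.
  apply: eq_bigr => l _; rewrite -/(c l).
  have lk : (l <= k)%N by rewrite -ltnS.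
  (* Parity leaves only even powers of the square root, which become powers of the product of
     squared norms. *)
  have [ho|he] := boolP (odd (k - l)); first by rewrite c_odd// !mul0r.
  rewrite -[in LHS](even_halfK he) -muln2 mulnC exprM sqr_sqrtr; last first.
    have := dotp_cauchy_schwarz (x i) z; have := dotp_cauchy_schwarz (x j) z.
    by rewrite !x1 z1 !mul1r => ? ?; rewrite mulr_ge0// subr_ge0.
  by rewrite mulrAC.
(* At the first basis vector [zonalker] equals [P(1) = 1], so the leading coefficient is
   nonnegative; the degree of [P] makes it nonzero. *)
have ck : 0 < c k.
  have [szP P1 _] := PP.
  have := @lead_zonal_ge0 R p.+2 k p c erefl c_rec c_odd
    (fun i => if i == ord0 then 1 else 0).
  rewrite (_ : zonalker _ _ _ _ = 1) ?mulr1; last first.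
    rewrite -[RHS](P1 k) horner_coef szP; apply: eq_bigr => l _.
    rewrite (_ : dotf _ _ = 1) ?mulr1 ?expr1n ?mulr1//.
    rewrite /dotf (bigD1 ord0)//= mulr1 big1 ?addr0// => i i0.
    by rewrite (negbTE i0) mulr0.
  rewrite le_eqVlt => /predU1P[c0|//].
  have : lead_coef (gegenbauer R p.+2 k) == 0.
    by rewrite lead_coefE szP -/(c k) -c0.
  by rewrite lead_coef_eq0 -size_poly_eq0 szP.
under eq_bigr do under eq_bigr do rewrite QE.
exact: (@zonalker_psd R p.+2 k p c).
Qed.
End Qker.

(** * Sums over triples of distinct points *)

Section distinct_triples.
Variables (R : pzRingType) (I : finType).
Implicit Types F : I -> I -> I -> R.

Definition distinct3 (i j l : I) := [&& i != j, i != l & j != l].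

Definition sum_distinct3 F := \sum_i \sum_j \sum_(l | distinct3 i j l) F i j l.

Lemma sum_distinct3_mkcond F : sum_distinct3 F =
  \sum_i \sum_j \sum_l if distinct3 i j l then F i j l else 0.
Proof. by do 2![apply: eq_bigr => ? _]; rewrite big_mkcond. Qed.

Lemma sum_distinct3_swap12 F :
  sum_distinct3 F = sum_distinct3 (fun i j l => F j i l).
Proof.
rewrite !sum_distinct3_mkcond exchange_big/=.
apply: eq_bigr => i _; apply: eq_bigr => j _; apply: eq_bigr => l _.
by rewrite /distinct3 [j == i]eq_sym [X in if _ && X then _ else _]andbC.
Qed.

Lemma sum_distinct3_swap23 F :
  sum_distinct3 F = sum_distinct3 (fun i j l => F i l j).
Proof.
rewrite !sum_distinct3_mkcond; apply: eq_bigr => i _; rewrite exchange_big/=.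
apply: eq_bigr => j _; apply: eq_bigr => l _.
by rewrite /distinct3 andbCA [l == j]eq_sym.
Qed.

Lemma sum_distinct3D F G : sum_distinct3 (fun i j l => F i j l + G i j l) =
  sum_distinct3 F + sum_distinct3 G.
Proof.
rewrite /sum_distinct3 -!big_split.
by do 2![apply: eq_bigr => ? _; rewrite -?big_split].
Qed.

Lemma sum_distinct3Z a F : sum_distinct3 (fun i j l => a * F i j l) =
  a * sum_distinct3 F.
Proof.
rewrite /sum_distinct3 !mulr_sumr.
by do 2![apply: eq_bigr => ? _; rewrite mulr_sumr].
Qed.

Lemma sum_distinct3_sum (J : Type) (s : seq J) (F : J -> I -> I -> I -> R) :
  sum_distinct3 (fun i j l => \sum_(p <- s) F p i j l) =
  \sum_(p <- s) sum_distinct3 (F p).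
Proof.
rewrite /sum_distinct3 [RHS]exchange_big; apply: eq_bigr => i _ /=.
rewrite [RHS]exchange_big; apply: eq_bigr => j _ /=.
by rewrite [RHS]exchange_big.
Qed.

Lemma eq_sum_distinct3 F G : (forall i j l, F i j l = G i j l) ->
  sum_distinct3 F = sum_distinct3 G.
Proof. by move=> FG; do 3![apply: eq_bigr => ? _]. Qed.

Lemma sum_distinct3_pair (h : I -> I -> R) :
  sum_distinct3 (fun i j _ => h i j) =
  (#|I| - 2)%:R * \sum_i \sum_(j | i != j) h i j.
Proof.
rewrite /sum_distinct3 mulr_sumr; apply: eq_bigr => i _.
rewrite mulr_sumr [RHS]big_mkcond; apply: eq_bigr => j _.
rewrite /distinct3; case: eqVneq => [_|ij]/=; first by rewrite big_pred0.
rewrite sumr_const -[LHS]mulr_natl; congr (1 *+ _ * _).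
rewrite -(cardC [set i; j]%SET) cards2 ij addKn.
by apply: eq_card => l; rewrite !inE negb_or ![l == _]eq_sym.
Qed.

(** Triples are sorted by coincidences: all equal, exactly two equal (three patterns), all
    distinct. *)
Lemma sum3_split F :
  \sum_i \sum_j \sum_l F i j l = \sum_i F i i i
    + \sum_i \sum_(j | i != j) (F i i j + F i j i + F i j j) + sum_distinct3 F.
Proof.
rewrite /sum_distinct3 -!big_split; apply: eq_bigr => i _ /=.
rewrite (bigD1 i)//= (bigD1 i)//= -!addrA; congr (_ + _).
rewrite [X in _ = _ + X](bigD1 i)//=.
rewrite [X in _ = _ + (X + _)]big_pred0; last first.
  by move=> l; rewrite /distinct3 eqxx.
rewrite add0r !big_split/= -!addrA.
under [X in X + _ = _]eq_bigl do rewrite eq_sym.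
congr (_ + _); rewrite addrA -big_split/= .
under [X in _ = X + _]eq_bigl do rewrite eq_sym.
rewrite -big_split/=; apply: eq_bigr => j ji.
rewrite (bigD1 i)//= (bigD1 j)//= addrA; congr (_ + _).
by apply: eq_bigl => l; rewrite /distinct3 [i == j]eq_sym ji /= ![l == _]eq_sym.
Qed.

End distinct_triples.

(** * Finitely supported sums *)

Section fsbig.
Variable R : realType.

(** Double counting over the fibres of [phi]: the multiplicities are supported on the finite image
    [X], where the two sums can be exchanged. *)
Lemma fsbig_count (T : choiceType) (J : finType) (P : pred J) (phi : J -> T)
    (D : set T) (g : T -> R) : (forall t, P t -> D (phi t)) ->
  finite_set [set w | D w /\ (\sum_(t | P t) (w == phi t)%:R : R) != 0] /\
  \sum_(w \in D) (\sum_(t | P t) (w == phi t)%:R) * g w =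
    \sum_(t | P t) g (phi t).
Proof.
move=> PD; pose X := undup [seq phi t | t in P].
have XD : [set` X] `<=` D.
  move=> w /=; rewrite mem_undup => /mapP[t].
  by rewrite mem_enum => Pt ->; exact: PD.
have X0 w : ~ w \in X -> \sum_(t | P t) (w == phi t)%:R = 0 :> R.
  move=> wX; rewrite big1// => t Pt; case: eqP => // wt; exfalso; apply: wX.
  by rewrite mem_undup; apply/mapP; exists t; rewrite ?mem_enum.
split.
  apply: (@sub_finite_set _ _ [set` X]) => [w /= [_]|]; last exact: finite_seq.
  by apply: contraNT => /negP wX; rewrite X0.
rewrite -(@fsbig_widen _ _ _ _ [set` X])//; last first.
  by move=> w /= [_ wX]; rewrite X0// mul0r.
rewrite -fsbig_seq ?undup_uniq//.
under eq_bigr do rewrite mulr_suml.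
rewrite exchange_big/=; apply: eq_bigr => t Pt.
rewrite (bigD1_seq (phi t)) ?undup_uniq//=; last first.
  by rewrite mem_undup; apply/mapP; exists t; rewrite ?mem_enum.
rewrite eqxx mul1r big1 ?addr0// => w /negbTE ->; by rewrite mul0r.
Qed.

(** Both sums restrict to the support of [v], enumerated without repetition. *)
Lemma infmx_psdP (M : nat -> nat -> R) :
  (forall (s : seq nat) (v : nat -> R),
     0 <= \sum_(i <- s) \sum_(j <- s) M i j * v i * v j) -> infmx_psd M.
Proof.
move=> M0 v /finite_seqP[s0 hs]; pose s := undup s0.
have s_ i : ~ i \in s -> v i = 0.
  move=> /negP; rewrite mem_undup => is0; apply/eqP/negPn/negP => vi.
  have : [set i | v i != 0] i by [].
  by rewrite hs /= (negbTE is0).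
have W (h : nat -> R) : (forall i, v i = 0 -> h i = 0) ->
    \sum_(i \in [set: nat]) h i = \sum_(i <- s) h i.
  move=> h0; rewrite -(@fsbig_widen _ _ _ _ [set` s])//.
    by rewrite -fsbig_seq// undup_uniq.
  by move=> i /= [_ /s_ vi]; exact: h0.
rewrite W; last first.
  by move=> i vi; rewrite fsbig1// => j _; rewrite vi mulr0 mul0r.
rewrite (eq_bigr (fun i => \sum_(j <- s) M i j * v i * v j))// => i _.
by rewrite W// => j vj; rewrite vj mulr0.
Qed.
End fsbig.

(** * The triple counts of a code as a feasible point of the program *)

Section three_point_bound.
Variables (R : realType) (n : nat) (I : finType) (x : I -> 'rV[R]_n).
Hypothesis hn : (3 <= n)%N.
Hypothesis hI : (2 <= #|I|)%N.
Hypothesis x1 : forall i, dotp (x i) (x i) = 1.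

Let G i j := dotp (x i) (x j).

Let GC i j : G i j = G j i. Proof. exact: dotpC. Qed.

Let Gii i : G i i = 1. Proof. exact: x1. Qed.

Section quadratic_form.
Variables (k : nat) (s : seq nat) (a : nat -> R).

(** The quadratic form of the unsymmetrized matrix at the vector [a] on [s]. It factors because the
    entries [u^i v^j] form a matrix of rank one. *)
Let E u v t :=
  (\sum_(p <- s) a p * u ^+ p) * (\sum_(q <- s) a q * v ^+ q) * Qker n k u v t.

Definition Sform := symmetrize E.

Lemma SformE u v t :
  \sum_(p <- s) \sum_(q <- s) Smx n k u v t p q * a p * a q = Sform u v t.
Proof.
have EE u' v' t' : E u' v' t' = \sum_(p <- s) \sum_(q <- s)
    u' ^+ p * v' ^+ q * Qker n k u' v' t' * a p * a q.
  rewrite /E mulr_suml mulr_suml; apply: eq_bigr => p _.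
  by rewrite mulr_sumr mulr_suml; apply: eq_bigr => q _; ring.
rewrite /Sform /symmetrize !EE -!big_split/= mulr_sumr; apply: eq_bigr => p _.
rewrite -!big_split/= mulr_sumr; apply: eq_bigr => q _.
by rewrite /Smx /symmetrize; ring.
Qed.

Lemma TformE N u v t :
  \sum_(p <- s) \sum_(q <- s) Tmx n N k u v t p q * a p * a q =
  (N%:R - 2) * Sform u v t + Sform u u 1 + Sform v v 1 + Sform t t 1.
Proof.
rewrite -!SformE mulr_sumr -!big_split/=; apply: eq_bigr => p _.
rewrite mulr_sumr -!big_split/=; apply: eq_bigr => q _.
by rewrite /Tmx; ring.
Qed.

Lemma Sform_swap12 u v t : Sform u v t = Sform v u t.
Proof. by rewrite /Sform /symmetrize; ring. Qed.

Lemma Sform_swap23 u v t : Sform u v t = Sform u t v.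
Proof. by rewrite /Sform /symmetrize; ring. Qed.

Lemma Sform111 : Sform 1 1 1 <= (k == 0%N)%:R * (\sum_(p <- s) a p) ^+ 2.
Proof.
have -> : Sform 1 1 1 = Qker n k 1 1 1 * (\sum_(p <- s) a p) ^+ 2.
  rewrite /Sform /symmetrize /E.
  under eq_bigr do rewrite expr1n mulr1.
  by field.
by rewrite ler_wpM2r ?sqr_ge0// Qker_diag_le.
Qed.

(** For each [l], this is [Qker_psd] with pole [x l] and the polynomial in [G i l] as weight of
    [x i]. *)
Let sumE_ge0 : 0 <= \sum_l \sum_i \sum_j E (G i l) (G j l) (G i j).
Proof.
apply: sumr_ge0 => l _.
exact: (@Qker_psd R n k I (index_enum I)
  (fun i => \sum_(p <- s) a p * G i l ^+ p) x (x l) hn (x1 l) x1).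
Qed.

(** Permuting [u], [v], [t] amounts to permuting the points of a triple, so symmetrization does not
    change the sum over all triples. *)
Lemma sum_Sform_ge0 : 0 <= \sum_i \sum_j \sum_l Sform (G i j) (G i l) (G j l).
Proof.
pose P l i j := E (G i l) (G j l) (G i j).
have -> : \sum_i \sum_j \sum_l Sform (G i j) (G i l) (G j l) =
    \sum_i \sum_j \sum_l 6^-1 *
      (P i j l + P j i l + P i l j + P l i j + P j l i + P l j i).
  apply: eq_bigr => i _; apply: eq_bigr => j _; apply: eq_bigr => l _.
  by rewrite /Sform /symmetrize /P (GC j i) (GC l i) (GC l j).
have T12 (F : I -> I -> I -> R) :
    \sum_i \sum_j \sum_l F j i l = \sum_i \sum_j \sum_l F i j l.
  by rewrite exchange_big.
have T23 (F : I -> I -> I -> R) :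
    \sum_i \sum_j \sum_l F i l j = \sum_i \sum_j \sum_l F i j l.
  by apply: eq_bigr => i _; rewrite exchange_big.
have -> : \sum_i \sum_j \sum_l 6^-1 *
    (P i j l + P j i l + P i l j + P l i j + P j l i + P l j i) =
    \sum_i \sum_j \sum_l P i j l.
  have -> : \sum_i \sum_j \sum_l P i j l = 6^-1 *
    (\sum_i \sum_j \sum_l P i j l + \sum_i \sum_j \sum_l P j i l
   + \sum_i \sum_j \sum_l P i l j + \sum_i \sum_j \sum_l P l i j
   + \sum_i \sum_j \sum_l P j l i + \sum_i \sum_j \sum_l P l j i).
    rewrite (T12 (fun i j l => P l i j)) (T12 (fun i j l => P i l j)).
    rewrite (T23 (fun i j l => P j i l)) (T12 P) (T23 P).
    by field.
  rewrite -!big_split mulr_sumr; apply: eq_bigr => i _.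
  rewrite -!big_split mulr_sumr; apply: eq_bigr => j _.
  by rewrite -!big_split mulr_sumr.
exact: sumE_ge0.
Qed.

(** Over distinct triples, the terms [S(u, u, 1)], [S(v, v, 1)], [S(t, t, 1)] sum to
    [3 (N - 2) pairs]. This is [N - 2] times the share of the triples with exactly two equal points
    in the full sum. *)
Lemma sum_Tform_ge0 :
  0 <= #|I|%:R * (#|I|%:R - 2) * (k == 0%N)%:R * (\sum_(p <- s) a p) ^+ 2
       + sum_distinct3 (fun i j l =>
           (#|I|%:R - 2) * Sform (G i j) (G i l) (G j l)
           + Sform (G i j) (G i j) 1 + Sform (G i l) (G i l) 1
           + Sform (G j l) (G j l) 1).
Proof.
set N := #|I|.
pose pairs := \sum_i \sum_(j | i != j) Sform (G i j) (G i j) 1.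
have N2 : (N - 2)%:R = N%:R - 2 :> R by rewrite natrB.
have N0 : 0 <= N%:R - 2 :> R by rewrite -N2 ler0n.
rewrite !sum_distinct3D sum_distinct3Z.
rewrite (sum_distinct3_swap12 (fun i j l => Sform (G j l) (G j l) 1)).
rewrite (sum_distinct3_swap23 (fun i j l => Sform (G i l) (G i l) 1)).
rewrite (sum_distinct3_pair (fun i j => Sform (G i j) (G i j) 1)) -/pairs N2.
have := sum_Sform_ge0; rewrite sum3_split.
under eq_bigr do rewrite !Gii.
rewrite sumr_const -/N -[_ *+ N]mulr_natl.
have -> : \sum_i \sum_(j | i != j) (Sform (G i i) (G i j) (G i j)
    + Sform (G i j) (G i i) (G j i) + Sform (G i j) (G i j) (G j j)) =
    3 * pairs.
  rewrite /pairs !mulr_sumr; apply: eq_bigr => i _.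
  rewrite !mulr_sumr; apply: eq_bigr => j _.
  rewrite (GC j i) !Gii (Sform_swap12 1) (Sform_swap23 _ 1); ring.
have := Sform111; move: (Sform 1 1 1) => W1; rewrite -subr_ge0 => DW total0.
(* The second summand is [N - 2] times the full sum over triples; the first is the slack of
   [Sform111] on the [N] constant triples. *)
rewrite [X in 0 <= X](_ : _ =
    N%:R * (N%:R - 2) * ((k == 0%N)%:R * (\sum_(p <- s) a p) ^+ 2 - W1)
    + (N%:R - 2) * (N%:R * W1 + 3 * pairs
      + sum_distinct3 (fun i j l =>
        Sform (G i j) (G i l) (G j l)))); last first.
  by ring.
by rewrite addr_ge0// mulr_ge0// mulr_ge0.
Qed.
End quadratic_form.

Definition triple_ip (t : I * I * I) : R * R * R :=
  (G t.1.1 t.1.2, G t.1.1 t.2, G t.1.2 t.2).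

Definition distinct_triple (t : I * I * I) := distinct3 t.1.1 t.1.2 t.2.

Definition triple_count (w : R * R * R) : R :=
  \sum_(t | distinct_triple t) (w == triple_ip t)%:R.

Lemma sum_distinct_triple (F : I -> I -> I -> R) :
  \sum_(t | distinct_triple t) F t.1.1 t.1.2 t.2 = sum_distinct3 F.
Proof.
rewrite sum_distinct3_mkcond [RHS]pair_big/= [RHS]pair_big/= big_mkcond.
by [].
Qed.

Hypothesis x_inj : injective x.

(** Injectivity of [x] keeps the inner products below 1; the last condition is the Gram
    determinant. *)
Lemma triple_ip_Dset t : distinct_triple t -> Dset (triple_ip t).
Proof.
case/and3P => ij il jl; split; try by apply: dotp_unit_itv; rewrite ?inj_eq.
exact: gram3_ge0.
Qed.

Lemma sum_triple_count (g : R * R * R -> R) :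
  \sum_(w \in @Dset R) triple_count w * g w =
  sum_distinct3 (fun i j l => g (G i j, G i l, G j l)).
Proof.
rewrite /triple_count (fsbig_count _ triple_ip_Dset).2.
exact: (sum_distinct_triple (fun i j l => g (G i j, G i l, G j l))).
Qed.

Lemma triple_count_feasible : sdp_feasible n #|I| triple_count.
Proof.
split.
- by move=> w _; apply: sumr_ge0 => t _; exact: ler0n.
- exact: (fsbig_count (fun=> 1) triple_ip_Dset).1.
(* With [g = 1], the total weight is the number of ordered triples of distinct indices. *)
- under eq_fsbigr do rewrite -[triple_count _]mulr1.
  rewrite sum_triple_count (sum_distinct3_pair (fun _ _ => 1)).
  rewrite (eq_bigr (fun=> (#|I| - 1)%:R)) => [|i _]; last first.
    rewrite sumr_const; congr (_ *+ _).
    rewrite -(cardC [set i]%SET) cards1 addKn.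
    by apply: eq_card => j; rewrite !inE eq_sym.
  rewrite sumr_const -mulr_natl !natrB ?(ltnW hI)//; ring.
- move=> k; apply: infmx_psdP => s a.
  have := sum_Tform_ge0 k s a; congr (0 <= _).
  rewrite (eq_sum_distinct3 (fun i j l =>
    esym (TformE k s a #|I| (G i j) (G i l) (G j l)))).
  rewrite sum_distinct3_sum expr2 mulr_suml.
  rewrite mulr_sumr -big_split; apply: eq_bigr => p _ /=.
  rewrite sum_distinct3_sum !mulr_sumr -big_split; apply: eq_bigr => q _ /=.
  rewrite [in RHS]mulrDl [in RHS]mulrDl; congr (_ + _); first by ring.
  have -> : \sum_(w \in @Dset R) (let: (u, v, t) := w in
      triple_count w * Tmx n #|I| k u v t p q) =
    sum_distinct3 (fun i j l => Tmx n #|I| k (G i j) (G i l) (G j l) p q).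
    rewrite -(sum_triple_count (fun w =>
      let: (u, v, t) := w in Tmx n #|I| k u v t p q)).
    by apply: eq_fsbigr => -[[u v] t] _.
  rewrite -mulrA [RHS]mulrC -sum_distinct3Z.
  by apply: eq_sum_distinct3 => i j l; ring.
Qed.

(** The three positions contribute equally, and [3 (N - 2) / (6 (N - 2)) = 1 / 2]. *)
Lemma triple_count_objective f : (2 < #|I|)%N ->
  sdp_objective #|I| f triple_count =
  2^-1 * \sum_i \sum_(j | i != j) f (G i j).
Proof.
move=> hI2; have N2 : (#|I| - 2)%:R = #|I|%:R - 2 :> R by rewrite natrB.
have N0 : #|I|%:R - 2 != 0 :> R by rewrite -N2 pnatr_eq0 subn_eq0 -ltnNge.
rewrite /sdp_objective.
have -> : \sum_(w \in @Dset R)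
    (let: (u, v, t) := w in triple_count w * (f u + f v + f t)) =
    sum_distinct3 (fun i j l => f (G i j) + f (G i l) + f (G j l)).
  rewrite -(sum_triple_count (fun w => let: (u, v, t) := w in f u + f v + f t)).
  by apply: eq_fsbigr => -[[u v] t] _.
rewrite !sum_distinct3D.
rewrite (sum_distinct3_swap12 (fun i j l => f (G j l))).
rewrite (sum_distinct3_swap23 (fun i j l => f (G i l))).
rewrite (sum_distinct3_pair (fun i j => f (G i j))) N2.
by field.
Qed.

End three_point_bound.

(** * From codes to injective families, and comparison of the two infima *)

Local Open Scope ereal_scope.

Theorem theorem6 (R : realType) (n N : nat) (f : R -> R)
  (hn : (3 <= n)%N) (hN : (2 < N)%N) :
  ereal_inf [set (sdp_objective N f A)%:E | A in @sdp_feasible R n N] <=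
  ereal_inf [set (energy f C)%:E | C in @sphere_codes R n N].
Proof.
apply: le_ereal_inf_tmp => _ [C [cardC C1] <-].
(* The code is indexed by its own elements, which makes the family injective. *)
pose x (i : C) : 'rV[R]_n := val i.
have cC : #|{: C}| = N by rewrite -cardC cardfE.
have x1 i : dotp (x i) (x i) = 1%R by apply: C1; exact: valP.
have x_inj : injective x by exact: val_inj.
have hI : (2 <= #|{: C}|)%N by rewrite cC ltnW.
(* The energy of [C] is itself an objective value, attained at the triple counts. *)
apply: ereal_inf_lbound; exists (triple_count x).
  rewrite -cC; exact: triple_count_feasible.
congr EFin; rewrite -[N]cC triple_count_objective//; last by rewrite cC.
rewrite /energy; congr (_ * _)%R.
rewrite big_seq_fsetE/=; apply: eq_bigr => i _.
by rewrite big_seq_fsetE.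
Qed.
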